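(* Let $\Delta\subset\mathbb{R}^n$ be a smooth lattice polytope with $\Delta\cap\mathbb{Z}^n=\{\mathbf{m}_0,\ldots,\mathbf{m}_\ell\}$, let $\{\Delta_1,\Delta_2\}$ be a semi-stable partition of $\Delta$ in two subpolytopes with $X_{\Delta_1},X_{\Delta_2}$ smooth, and let $F$ and $G$ be the two associated lifting functions. Then $\tilde X_F$ and $\tilde X_G$ have the same equations in $\mathbb{P}^\ell\times\mathbb{C}$, i.e. $I_F=I_G$ as ideals of $\mathbb{C}[x_0,\ldots,x_\ell,\eta]$.
   Context: Polytopes. The lattice is $M=\mathbb{Z}^n\subset\mathbb{R}^n$. $\Delta\subset\mathbb{R}^n$ is a compact convex $n$-dimensional lattice polytope whose toric variety $X_\Delta$ (given by its normal fan) is smooth. Its lattice points are $\Delta\cap\mathbb{Z}^n=\{\mathbf{m}_0,\ldots,\mathbf{m}_\ell\}$, with $\mathbf{m}_j=(m_{1j},\ldots,m_{nj})$. Partition. $\Gamma=\{\Delta_1,\Delta_2\}$ is a partition (polyhedral subdivision) of $\Delta$ in two $n$-dimensional lattice subpolytopes such that the toric varieties $X_{\Delta_1}$, $X_{\Delta_2}$ are smooth. Faces are understood to be relatively open. An $l$-face of $\Gamma$ is an open $l$-dimensional face of some $\Delta_j$, with the convention that the $0$-faces of $\Delta$ are not $0$-faces of $\Gamma$. $\Gamma$ is semi-stable if for any $l$-face $\sigma$ of $\Gamma$, if $\theta$ is the $k$-face of $\Delta$ such that $\sigma\subset\theta$, then there are exactly $k-l+1$ of the $\Delta_j$'s such that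 $\sigma$ is a face of each of them. Lifting functions. Let $a_1y_1+\cdots+a_ny_n+a_{n+1}=0$, with $a_1,\ldots,a_{n+1}\in\mathbb{Z}$, be an equation of the hyperplane containing the cut $\Delta_1\cap\Delta_2$, with signs chosen so that $a_1m_{1j}+\cdots+a_nm_{nj}+a_{n+1}\ge 0$ for all $\mathbf{m}_j\in\Delta_2\cap\mathbb{Z}^n$. (Then the left-hand side is $\le 0$ on $\Delta_1$ and $0$ on $\Delta_1\cap\Delta_2$.) The two lifting functions are $$F(\mathbf{m}_j)=\begin{cases}0 & \mathbf{m}_j\in\Delta_1\\ a_1m_{1j}+\cdots+a_nm_{nj}+a_{n+1} & \mathbf{m}_j\in\Delta_2,\end{cases}\qquad G(\mathbf{m}_j)=\begin{cases}-a_1m_{1j}-\cdots-a_nm_{nj}-a_{n+1} & \mathbf{m}_j\in\Delta_1\\ 0 & \mathbf{m}_j\in\Delta_2.\end{cases}$$ Varieties. For $H\in\{F,G\}$, $\tilde X_H\subset\mathbb{P}^\ell\times\mathbb{C}$ is the Zariski closure of the image of $$\psi_H:(\mathbb{C}^* )^n\times\mathbb{C}\to\mathbb{P}^\ell\times\mathbb{C},\qquad (\mathbf{t},\lambda)\mapsto([\lambda^{H(\mathbf{m}_0)}\mathbf{t}^{\mathbf{m}_0},\ldots,\lambda^{H(\mathbf{m}_\ell)}\mathbf{t}^{\mathbf{m}_\ell}],\lambda),$$ where $\mathbf{t}^{\mathbf{u}}=t_1^{u_1}\cdots t_n^{u_n}$ and $\lambda^0=1$ (also for $\lambda=0$). Ideals.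 Let $x_0,\ldots,x_\ell$ be homogeneous coordinates on $\mathbb{P}^\ell$ and $\eta$ the coordinate on $\mathbb{C}$. $I_H\subset\mathbb{C}[x_0,\ldots,x_\ell,\eta]$ is the ideal generated by all polynomials that are homogeneous in $x_0,\ldots,x_\ell$ and vanish on $\tilde X_H$. *)

(* Defs.v *)
(* [R : realType] is the field of real numbers and [R[i]] that of complex
   numbers throughout. *)
From HB Require Import structures.
From mathcomp Require Import all_boot all_order all_algebra.
From mathcomp Require Import boolp classical_sets reals.
From mathcomp Require Import mpoly complex.

Set Implicit Arguments.
Unset Strict Implicit.
Unset Printing Implicit Defensive.

Import Order.TTheory GRing.Theory Num.Theory.
Local Open Scope classical_set_scope.
Local Open Scope ring_scope.
Local Open Scope complex_scope.

(** * Convex geometry in R^n *)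

Definition dot (A : comPzRingType) (n : nat) (u v : 'rV[A]_n) : A :=
  \sum_(i < n) u 0 i * v 0 i.

Definition lat (R : realType) (n : nat) (u : 'rV[int]_n) : 'rV[R]_n :=
  map_mx intr u.
Arguments lat R {n} u.

Definition affine_hull (R : realType) (n : nat) (S : set 'rV[R]_n) :
    set 'rV[R]_n :=
  [set x | exists (k : nat) (w : 'I_k -> R) (p : 'I_k -> 'rV[R]_n),
    [/\ forall i, S (p i), \sum_i w i = 1 & x = \sum_i w i *: p i]].

Definition convex_hull (R : realType) (n : nat) (S : set 'rV[R]_n) :
    set 'rV[R]_n :=
  [set x | exists (k : nat) (w : 'I_k -> R) (p : 'I_k -> 'rV[R]_n),
    [/\ forall i, S (p i), forall i, 0 <= w i, \sum_i w i = 1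
      & x = \sum_i w i *: p i]].

(* The empty set has no dimension. *)
Definition has_dim (R : realType) (n : nat) (S : set 'rV[R]_n) (k : nat) :
    Prop :=
  exists (x0 : 'rV[R]_n) (V : {vspace 'rV[R]_n}),
    \dim V = k /\ affine_hull S = [set x | x - x0 \in V].

Definition relint (R : realType) (n : nat) (S : set 'rV[R]_n) :
    set 'rV[R]_n :=
  [set x | S x /\ exists2 e : R, 0 < e &
    forall y, affine_hull S y -> (forall i, `|y 0 i - x 0 i| < e) -> S y].

Definition lattice_polytope (R : realType) (n : nat) (P : set 'rV[R]_n) :
    Prop :=
  exists s : seq 'rV[int]_n, P = convex_hull [set lat R u | u in [set` s]].

(* Closed faces, cut out by a valid inequality; [P] itself (u = 0, b = 0) and
   the empty set (u = 0, b = 1) are faces. *)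
Definition closed_face (R : realType) (n : nat) (P F : set 'rV[R]_n) : Prop :=
  exists (u : 'rV[R]_n) (b : R),
    (forall x, P x -> dot u x <= b) /\ F = [set x | P x /\ dot u x = b].

Definition open_face (R : realType) (n : nat) (P : set 'rV[R]_n) (k : nat)
    (s : set 'rV[R]_n) : Prop :=
  exists F : set 'rV[R]_n, [/\ closed_face P F, has_dim F k & s = relint F].

(** * The toric variety of a full-dimensional lattice polytope *)

(* Cones of the (inner) normal fan, one for each nonempty face. *)
Definition normal_cone (R : realType) (n : nat) (P F : set 'rV[R]_n) :
    set 'rV[R]_n :=
  [set v | forall x y, F x -> P y -> dot x v <= dot y v].

Definition normal_fan (R : realType) (n : nat) (P : set 'rV[R]_n) :
    set (set 'rV[R]_n) :=
  [set c | exists F, [/\ closed_face P F, F !=set0 & c = normal_cone P F]].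

(* The semigroup of lattice points of the dual cone: the affine chart attached
   to the cone [c] is Spec C[dual_semigroup c]. *)
Definition dual_semigroup (R : realType) (n : nat) (c : set 'rV[R]_n) :
    set 'rV[int]_n :=
  [set u | forall v, c v -> 0 <= dot (lat R u) v].

(* Closed points of Spec C[S] are the C-algebra morphisms C[S] -> C, i.e. the
   morphisms from S to the multiplicative monoid C.  Only the values on S
   matter; outside S they are normalized to 0. *)
Definition chart_point (R : realType) (n : nat) (S : set 'rV[int]_n)
    (p : 'rV[int]_n -> R[i]) : Prop :=
  [/\ p 0 = 1,
      forall u v, S u -> S v -> p (u + v) = p u * p v
    & forall u, ~ S u -> p u = 0].

(* The Zariski tangent space of Spec C[S] at p consists of the C-derivations
   C[S] -> C at p, given by their values on the basis S of C[S]. *)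
Definition tangent_vector (R : realType) (n : nat) (S : set 'rV[int]_n)
    (p : 'rV[int]_n -> R[i]) (D : 'rV[int]_n -> R[i]) : Prop :=
  (forall u v, S u -> S v -> D (u + v) = p u * D v + p v * D u) /\
  (forall u, ~ S u -> D u = 0).

(* The tangent space at p has a basis of d vectors. *)
Definition tangent_dim (R : realType) (n : nat) (S : set 'rV[int]_n)
    (p : 'rV[int]_n -> R[i]) (d : nat) : Prop :=
  exists e : 'I_d -> 'rV[int]_n -> R[i],
    (forall i, tangent_vector S p (e i)) /\
    (forall D, tangent_vector S p D ->
       exists! c : 'rV[R[i]]_d, forall u, D u = \sum_(i < d) c 0 i * e i u).

(* X_P, of dimension n, is covered by the affine charts of the cones of the
   normal fan of P, so it is smooth iff at every point of every chart the
   tangent space has dimension n. *)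
Definition smooth_toric (R : realType) (n : nat) (P : set 'rV[R]_n) : Prop :=
  forall c, normal_fan P c ->
  forall p : 'rV[int]_n -> R[i], chart_point (dual_semigroup c) p ->
    tangent_dim (dual_semigroup c) p n.

(** * Subdivisions *)

Definition lattice_subdivision (R : realType) (n : nat) (P : set 'rV[R]_n)
    (I : finType) (G : I -> set 'rV[R]_n) : Prop :=
  [/\ forall j, lattice_polytope (G j) /\ has_dim (G j) n,
      injective G,
      P = \bigcup_(j in [set: I]) G j
    & forall j k, closed_face (G j) (G j `&` G k)].

(* The 0-faces of P are not 0-faces of the subdivision. *)
Definition subdivision_face (R : realType) (n : nat) (P : set 'rV[R]_n)
    (I : finType) (G : I -> set 'rV[R]_n) (l : nat) (s : set 'rV[R]_n) :
    Prop :=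
  (exists j, open_face (G j) l s) /\ ~ (l = 0%N /\ open_face P 0 s).

Definition semi_stable (R : realType) (n : nat) (P : set 'rV[R]_n)
    (I : finType) (G : I -> set 'rV[R]_n) : Prop :=
  forall (l k : nat) (s t : set 'rV[R]_n),
    subdivision_face P G l s -> open_face P k t -> s `<=` t ->
    #|[set j : I | `[< open_face (G j) l s >]]%SET| = (k - l + 1)%N.

Definition two_pieces (R : realType) (n : nat) (D1 D2 : set 'rV[R]_n)
    (j : 'I_2) : set 'rV[R]_n :=
  if j == ord0 then D1 else D2.

(** * Lifting functions *)

Definition liftF (R : realType) (n l : nat) (D1 : set 'rV[R]_n)
    (m : 'I_l.+1 -> 'rV[int]_n) (a : 'rV[int]_n) (a0 : int) (j : 'I_l.+1) :
    int :=
  if lat R (m j) \in D1 then 0 else dot a (m j) + a0.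

Definition liftG (R : realType) (n l : nat) (D2 : set 'rV[R]_n)
    (m : 'I_l.+1 -> 'rV[int]_n) (a : 'rV[int]_n) (a0 : int) (j : 'I_l.+1) :
    int :=
  if lat R (m j) \in D2 then 0 else - dot a (m j) - a0.

(** * Zariski topology of P^l x C *)

(* P^l is the set of lines through 0 in C^(l+1). *)
Definition proj_space (R : realType) (l : nat) : Type :=
  {L : {vspace 'rV[R[i]]_l.+1} | \dim L == 1%N}.

(* In C[x_0,...,x_l,eta] = {mpoly R[i][l.+2]} the variables x_0,...,x_l come
   first and eta, of index [ord_max], is the last one. *)
Definition xvar (l : nat) (i : 'I_l.+1) : 'I_l.+2 := widen_ord (leqnSn _) i.

Definition x_homogeneous (R : realType) (l : nat) (p : {mpoly R[i][l.+2]}) :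
    Prop :=
  exists d : nat, forall mon, mon \in msupp p ->
    (\sum_(i < l.+1) mon (xvar i))%N = d.

Definition coords (R : realType) (l : nat) (v : 'rV[R[i]]_l.+1) (t : R[i])
    (k : 'I_l.+2) : R[i] :=
  if unlift ord_max k is Some i then v 0 i else t.

Definition vanishes_at (R : realType) (l : nat) (p : {mpoly R[i][l.+2]})
    (x : proj_space R l * R[i]) : Prop :=
  forall v, v \in val x.1 -> v != 0 -> p.@[coords v x.2] = 0.

Definition zero_locus (R : realType) (l : nat) (E : set {mpoly R[i][l.+2]}) :
    set (proj_space R l * R[i]) :=
  [set x | forall p, E p -> vanishes_at p x].

Definition zariski_closed (R : realType) (l : nat)
    (Z : set (proj_space R l * R[i])) : Prop :=
  exists E : set {mpoly R[i][l.+2]},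
    (forall p, E p -> x_homogeneous p) /\ Z = zero_locus E.

Definition zariski_closure (R : realType) (l : nat)
    (A : set (proj_space R l * R[i])) : set (proj_space R l * R[i]) :=
  [set x | forall Z, zariski_closed Z -> A `<=` Z -> Z x].

(** * The varieties and their ideals *)

(* Integer powers: 0 ^ 0 = 1 and 0 ^ k = 0 for k > 0. *)
Definition psi_coords (R : realType) (n l : nat) (m : 'I_l.+1 -> 'rV[int]_n)
    (H : 'I_l.+1 -> int) (t : 'I_n -> R[i]) (lam : R[i]) :
    'rV[R[i]]_l.+1 :=
  \row_(j < l.+1) (lam ^ H j * \prod_(i < n) t i ^ m j 0 i).

Definition psi_image (R : realType) (n l : nat) (m : 'I_l.+1 -> 'rV[int]_n)
    (H : 'I_l.+1 -> int) : set (proj_space R l * R[i]) :=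
  [set x | exists t : 'I_n -> R[i],
    (forall i, t i != 0) /\ val x.1 = <[psi_coords m H t x.2]>%VS].

Definition Xtilde (R : realType) (n l : nat) (m : 'I_l.+1 -> 'rV[int]_n)
    (H : 'I_l.+1 -> int) : set (proj_space R l * R[i]) :=
  zariski_closure (psi_image m H).
Arguments Xtilde R {n l} m H.

Definition ideal_generated (A : comPzRingType) (E : set A) : set A :=
  [set p | exists s : seq (A * A),
    (forall q, q \in s -> E q.2) /\ p = \sum_(q <- s) q.1 * q.2].

Definition ideal_of (R : realType) (n l : nat) (m : 'I_l.+1 -> 'rV[int]_n)
    (H : 'I_l.+1 -> int) : set {mpoly R[i][l.+2]} :=
  ideal_generated
    [set p : {mpoly R[i][l.+2]} |
      x_homogeneous p /\ forall x, Xtilde R m H x -> vanishes_at p x].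
Arguments ideal_of R {n l} m H.

(* Main.v *)
Require Import Defs.
From HB Require Import structures.
From mathcomp Require Import all_boot all_order all_algebra.
From mathcomp Require Import boolp classical_sets reals complex.
From mathcomp Require mpoly.
From mathcomp Require Import topology normedtype ring.

Set Implicit Arguments.
Unset Strict Implicit.
Unset Printing Implicit Defensive.

Import Order.TTheory GRing.Theory Num.Theory.
Import numFieldNormedType.Exports.
Local Open Scope classical_set_scope.
Local Open Scope ring_scope.

(** Write [f x] for the affine function [dot a x + a0] defining the cut.

    The two lifting functions differ by an affine function: [F = G + f] at every
    lattice point ([liftF_liftG]).  Multiplying the coordinates [t_i] by a power
    of [lam] absorbs the linear part of [f], and the constant [lam ^ a0]
    disappears in projective space; so the images of the two
    parametrizations coincide over [lam != 0] ([psi_image_shift]).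

    Over [lam = 0] the images are genuinely different, but each lies in the
    closure of the part of its family over [lam != 0]
    ([zariski_closure_special]): when the exponents are nonnegative, a
    polynomial evaluated along [lam |-> psi_coords m H t lam] is a polynomial in
    [lam], and if it vanishes for [lam != 0] it vanishes at [0].  Hence the two
    closures, and with them the two ideals, are equal.

    This uses [0 <= F] and [0 <= G].  The first is the choice of signs in [f].
    The second says that the first piece lies on the other side of the cut
    ([opposite_sides]).  Indeed [D2] has full dimension and [0 <= f] on it, so
    [0 < f y] at some [y] of [D2].  If also [0 < f x] with [x] in [D1], then
    [0 < f] on the segment from [x] to [y]; but this segment lies in
    [D = D1 `|` D2], and being connected and covered by two closed sets it meets
    [D1 `&` D2] ([segment_meets]), where [f = 0]. *)

(** * Affine functions on lattice polytopes *)

Lemma dot_lat (R : realType) n (u v : 'rV[int]_n) :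
  dot (lat R u) (lat R v) = (dot u v)%:~R.
Proof.
rewrite /dot rmorph_sum; apply: eq_bigr => i _.
by rewrite !mxE -intrM.
Qed.

Lemma dot_sumr (A : comPzRingType) n (I : finType) (u : 'rV[A]_n)
    (w : I -> A) (p : I -> 'rV[A]_n) :
  dot u (\sum_i w i *: p i) = \sum_i w i * dot u (p i).
Proof.
under [RHS]eq_bigr do rewrite /dot mulr_sumr.
rewrite /dot exchange_big; apply: eq_bigr => i _ /=.
rewrite summxE mulr_sumr; apply: eq_bigr => j _.
by rewrite mxE mulrCA.
Qed.

Lemma affine_sumr (A : comPzRingType) n (I : finType) (u : 'rV[A]_n) (b : A)
    (w : I -> A) (p : I -> 'rV[A]_n) : \sum_i w i = 1 ->
  dot u (\sum_i w i *: p i) + b = \sum_i w i * (dot u (p i) + b).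
Proof.
move=> w1; under [RHS]eq_bigr do rewrite mulrDr.
by rewrite big_split -mulr_suml w1 mul1r dot_sumr.
Qed.

Lemma lat_eq0 (R : realType) n (u : 'rV[int]_n) :
  (forall x, dot (lat R u) x = 0) -> u = 0.
Proof.
move=> u0; apply/rowP => i; rewrite mxE.
have := u0 (delta_mx 0 i); rewrite /dot (bigD1 i) //= big1 => [|j ji].
  by rewrite !mxE !eqxx mulr1 addr0 => /eqP; rewrite intr_eq0 => /eqP.
by rewrite !mxE (negPf ji) andbF mulr0.
Qed.

(** The affine hull of a set of full dimension is the whole space, and a
    nonconstant affine function cannot vanish there. *)
Lemma full_dim_affine_neq0 (R : realType) n (S : set 'rV[R]_n)
    (a : 'rV[int]_n) (b : R) : has_dim S n -> a != 0 ->
  exists2 x, S x & dot (lat R a) x + b != 0.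
Proof.
move=> [x0 [V [dimV affS]]] /eqP a0; apply: contrapT => noS.
have S0 x : S x -> dot (lat R a) x + b = 0.
  by move=> Sx; apply/eqP/negPn/negP => nx; apply: noS; exists x.
have all0 x : dot (lat R a) x + b = 0.
  have : affine_hull S x.
    rewrite affS /=; have -> : V = fullv.
      by apply/eqP; rewrite eqEdim subvf dimvf dimV /dim /= mul1n.
    by rewrite memvf.
  move=> [k [w [p [Sp w1 ->]]]]; rewrite affine_sumr //.
  by apply: big1 => i _; rewrite S0 // mulr0.
have b0 : b = 0.
  have := all0 0; rewrite /dot big1 ?add0r // => i _.
  by rewrite [X in _ * X]mxE mulr0.
by apply/a0/(@lat_eq0 R) => x; have := all0 x; rewrite b0 addr0.
Qed.

(** * Closed convexity of lattice polytopes *)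

Definition simplex (R : realType) k : set 'rV[R]_k :=
  [set w | (forall i, 0 <= w 0 i) /\ \sum_i w 0 i = 1].

(** A lattice polytope is the image of one standard simplex under a linear map,
    obtained by adding up the weights of equal vertices.  Convexity and
    compactness are then inherited from the simplex. *)
Lemma lattice_polytopeP (R : realType) n (P : set 'rV[R]_n) :
  lattice_polytope P -> exists k (p : 'I_k -> 'rV[int]_n),
    (forall i, P (lat R (p i))) /\
    P = [set \sum_i w 0 i *: lat R (p i) | w in @simplex R k].
Proof.
move=> [s ->]; exists (size s), (tnth (in_tuple s)); split=> [i|].
  exists 1%N, (fun=> 1), (fun=> lat R (tnth (in_tuple s) i)).
  split=> //; rewrite ?big_ord1 ?scale1r// => _.
  by exists (tnth (in_tuple s) i) => //=; rewrite mem_tnth.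
apply/seteqP; split=> x.
  move=> [k [w [p [ps w0 w1 ->]]]].
  have /choice[f fP] i : exists j, p i = lat R (tnth (in_tuple s) j).
    have [u us <-] := ps i.
    by have /tnthP[j ->] : u \in in_tuple s by []; exists j.
  exists (\row_j \sum_(i | f i == j) w i).
    split=> [j|]; first by rewrite mxE sumr_ge0.
    under eq_bigr do rewrite mxE.
    by rewrite -w1 [RHS](partition_big f xpredT).
  rewrite [RHS](partition_big f xpredT) //=; apply: eq_bigr => j _.
  by rewrite mxE scaler_suml; apply: eq_bigr => i /eqP <-; rewrite fP.
move=> [w [w0 w1] <-]; exists (size s), (w 0).
exists (fun i => lat R (tnth (in_tuple s) i)).
by split=> // i; exists (tnth (in_tuple s) i) => //=; rewrite mem_tnth.
Qed.

Lemma continuous_sumr (T : topologicalType) (K : numFieldType)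
    (V : normedModType K) (I : Type) (r : seq I) (f : I -> T -> V) :
  (forall i, continuous (f i)) -> continuous (fun x => \sum_(i <- r) f i x).
Proof.
move=> fc x; elim: r => [|i r IHr].
  by under eq_fun do rewrite big_nil; exact: cvg_cst.
under eq_fun do rewrite big_cons.
by apply: cvgD => //; exact: fc.
Qed.

Lemma simplex_compact (R : realType) k : compact (@simplex R k).
Proof.
have cbox : compact [set w : 'rV[R]_k | forall i, `[0, 1]%classic (w ord0 i)].
  apply: (@rV_compact R k (fun=> `[0, 1]%classic)) => i.
  exact: segment_compact.
apply: (subclosed_compact _ cbox).
  have -> : @simplex R k =
      (\bigcap_(i in [set: 'I_k]) [set w | 0 <= w 0 i]) `&`
      [set w | \sum_i w 0 i = 1].
    by apply/seteqP; split=> w [w0 w1]; split=> // i; [move=> _|]; exact: w0.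
  apply: closedI.
    apply: closed_bigI => i _.
    apply: (@preimage_closed _ _ (fun w : 'rV[R]_k => w 0 i) [set x | 0 <= x]).
      by move=> w _; exact: coord_continuous.
    exact: closed_ge.
  apply: (@preimage_closed _ _ (fun w : 'rV[R]_k => \sum_i w 0 i)
    [set x | x = 1]).
    by move=> w _; apply: continuous_sumr => i; exact: coord_continuous.
  exact: closed_eq.
move=> w [w0 w1] i /=; rewrite in_itv /= w0 /= -w1 (bigD1 i) //= lerDl.
by rewrite sumr_ge0.
Qed.

Lemma lattice_polytope_closed (R : realType) n (P : set 'rV[R]_n) :
  lattice_polytope P -> closed P.
Proof.
move=> /lattice_polytopeP[k [p [_ ->]]].
apply: compact_closed; first exact: norm_hausdorff.
apply: continuous_compact; last exact: simplex_compact.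
apply: continuous_subspaceT; apply: continuous_sumr => i w.
exact: (cvgZr_tmp (a := lat R (p i)) (@coord_continuous R 1 k 0 i w)).
Qed.

Lemma lattice_polytope_segment (R : realType) n (P : set 'rV[R]_n) x y (t : R) :
  lattice_polytope P -> P x -> P y -> 0 <= t <= 1 -> P ((1 - t) *: x + t *: y).
Proof.
move=> /lattice_polytopeP[k [p [_ ->]]] [w [w0 w1] <-] [v [v0 v1] <-].
move=> /andP[t0 t1]; exists ((1 - t) *: w + t *: v).
  split=> [i|]; first by rewrite !mxE addr_ge0 ?mulr_ge0 ?subr_ge0.
  under eq_bigr do rewrite !mxE.
  by rewrite big_split /= -!mulr_sumr w1 v1 !mulr1 subrK.
rewrite !scaler_sumr -big_split; apply: eq_bigr => i _ /=.
by rewrite !scalerA -scalerDl; congr (_ *: _); rewrite !mxE.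
Qed.

(** The parameters [t] whose point lies in [A] form a subset of [[0, 1]] that is
    closed; were [A `&` B] to miss the segment, it would also be the complement
    of those whose point lies in [B], hence open, against connectedness. *)
Lemma segment_meets (R : realType) n (P A B : set 'rV[R]_n) x y :
  lattice_polytope P -> closed A -> closed B -> P = A `|` B ->
  A x -> B y -> exists2 t : R, 0 <= t <= 1 & (A `&` B) ((1 - t) *: x + t *: y).
Proof.
move=> Ppoly cA cB PAB Ax By; apply: contrapT => noAB.
pose z (t : R) := (1 - t) *: x + t *: y.
have zAB t : 0 <= t <= 1 -> ~ (A `&` B) (z t).
  by move=> t01 ABt; apply: noAB; exists t.
have zP t : 0 <= t <= 1 -> A (z t) \/ B (z t).
  move=> t01; suff : P (z t) by rewrite PAB.
  by apply: lattice_polytope_segment => //; rewrite PAB; [left|right].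
have zc : continuous z.
  move=> t; apply: cvgD; apply: cvgZr_tmp; last exact: cvg_id.
  by apply: cvgB; [exact: cvg_cst | exact: cvg_id].
have z0 : z 0 = x by rewrite /z subr0 scale1r scale0r addr0.
have z1 : z 1 = y by rewrite /z subrr scale1r scale0r add0r.
have in01 (t : R) : `[0, 1]%classic t = (0 <= t <= 1) by rewrite /= in_itv.
suff : `[0, 1]%classic `&` z @^-1` A = `[0, 1]%classic.
  move=> /seteqP[_ /(_ 1)]; rewrite in01 ler01 lexx => /(_ isT)[_ Az1].
  by apply: (@zAB 1); rewrite ?ler01 ?lexx //; split; rewrite // z1.
apply: (@segment_connected R 0 1).
- by exists 0; split; rewrite ?in01 ?lexx ?ler01 //= z0.
- exists (z @^-1` (~` B)).
    by apply: open_comp => [t _|]; [exact: zc | exact: closed_openC].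
  apply/seteqP; split=> t [t01 zt]; split=> //; move: t01; rewrite in01 => t01.
    by move=> Bt; exact: (zAB t).
  by case: (zP t).
- by exists (z @^-1` A) => //; apply: preimage_closed => // t _; exact: zc.
Qed.

Lemma opposite_sides (R : realType) n (P A B : set 'rV[R]_n) (u : 'rV[R]_n)
    (b : R) :
  lattice_polytope P -> closed A -> closed B -> P = A `|` B ->
  (forall x, (A `&` B) x -> dot u x + b = 0) ->
  (exists2 y, B y & 0 < dot u y + b) ->
  forall x, A x -> dot u x + b <= 0.
Proof.
move=> Ppoly cA cB PAB cut [y By uy] x Ax; rewrite leNgt; apply/negP => ux.
have [t /andP[t0 t1] /cut] := segment_meets Ppoly cA cB PAB Ax By.
pose w (i : 'I_2) := if i == ord0 then 1 - t else t.
pose p (i : 'I_2) := if i == ord0 then x else y.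
have w1 : \sum_i w i = 1 by rewrite !big_ord_recl big_ord0 addr0 subrK.
have -> : (1 - t) *: x + t *: y = \sum_i w i *: p i.
  by rewrite !big_ord_recl big_ord0 addr0.
rewrite affine_sumr // !big_ord_recl big_ord0 addr0 /w /p /=.
apply/eqP; rewrite gt_eqF //; have [->|t_neq0] := eqVneq t 0.
  by rewrite mul0r addr0 subr0 mul1r.
apply: ltr_wpDl; first by rewrite mulr_ge0 ?subr_ge0 // ltW.
by rewrite mulr_gt0 // lt_neqAle eq_sym t_neq0.
Qed.

(** * The two lifting functions *)

Section LiftingFunctions.
Variables (R : realType) (n l : nat) (D D1 D2 : set 'rV[R]_n).
Variables (m : 'I_l.+1 -> 'rV[int]_n) (a : 'rV[int]_n) (a0 : int).
Hypothesis D_polytope : lattice_polytope D.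
Hypothesis m_range : range m = [set u | D (lat R u)].
Hypothesis subdiv : lattice_subdivision D (two_pieces D1 D2).
Hypothesis a_neq0 : a != 0.
Hypothesis a_cut : forall x, (D1 `&` D2) x -> dot (lat R a) x + a0%:~R = 0.
Hypothesis a_sign : forall j, D2 (lat R (m j)) -> 0 <= dot a (m j) + a0.

Lemma subdivision_cover : D = D1 `|` D2.
Proof.
have [_ _ -> _] := subdiv; apply/seteqP; split=> x.
  by move=> [j _]; rewrite /two_pieces; case: ifP; [left|right].
by case=> [D1x|D2x]; [exists ord0 | exists ord_max].
Qed.

Lemma affine_lat j :
  dot (lat R a) (lat R (m j)) + a0%:~R = (dot a (m j) + a0)%:~R.
Proof. by rewrite dot_lat -intrD. Qed.

(** The sign of the cut is known at lattice points only, but these include the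
    vertices of [D2]. *)
Lemma affine_ge0 x : D2 x -> 0 <= dot (lat R a) x + a0%:~R.
Proof.
have [/(_ ord_max)[D2poly _] _ _ _] := subdiv.
have {}D2poly : lattice_polytope D2 := D2poly.
have [k [p [D2p ->]]] := lattice_polytopeP D2poly.
move=> [w [w0 w1] <-]; rewrite affine_sumr // sumr_ge0 // => i _.
apply: mulr_ge0 => //; have D2i := D2p i; move: D2i.
have : [set u | D (lat R u)] (p i) by rewrite /= subdivision_cover; right.
rewrite -m_range => -[j _ <-] D2j.
by rewrite affine_lat ler0z a_sign.
Qed.

Lemma affine_le0 j : D1 (lat R (m j)) -> dot a (m j) + a0 <= 0.
Proof.
move=> D1j; rewrite -(lerz0 R) -affine_lat.
have [poly _ _ _] := subdiv.
have [D1poly _] : lattice_polytope D1 /\ _ := poly ord0.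
have [D2poly D2dim] : lattice_polytope D2 /\ has_dim D2 n := poly ord_max.
apply: (opposite_sides D_polytope (lattice_polytope_closed D1poly)
  (lattice_polytope_closed D2poly) subdivision_cover) => //.
have [y D2y y_neq0] := full_dim_affine_neq0 a0%:~R D2dim a_neq0.
by exists y; rewrite // lt_neqAle eq_sym y_neq0 affine_ge0.
Qed.

Lemma lattice_point_cases j : D1 (lat R (m j)) \/ D2 (lat R (m j)).
Proof.
suff : D (lat R (m j)) by rewrite subdivision_cover.
by have : range m (m j) by []; rewrite m_range.
Qed.

Lemma liftF_ge0 j : 0 <= liftF D1 m a a0 j.
Proof.
rewrite /liftF; case: ifPn => // /negP; rewrite in_setE => nD1.
by apply: a_sign; have [] := lattice_point_cases j.
Qed.

Lemma liftG_ge0 j : 0 <= liftG D2 m a a0 j.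
Proof.
rewrite /liftG; case: ifPn => // /negP; rewrite in_setE => nD2.
rewrite -opprD oppr_ge0.
by apply: affine_le0; have [] := lattice_point_cases j.
Qed.

(** Both sides are [0] on [D1] and the affine function on [D2]; on the overlap
    of the two cases the affine function vanishes. *)
Lemma liftF_liftG j : liftF D1 m a a0 j = liftG D2 m a a0 j + dot a (m j) + a0.
Proof.
rewrite /liftF /liftG -addrA; case: ifPn => [|/negP]; rewrite in_setE => D1j;
    case: ifPn => [|/negP]; rewrite in_setE => D2j.
- apply/esym; rewrite add0r; apply/eqP; rewrite -(intr_eq0 R) -affine_lat.
  by rewrite a_cut.
- by rewrite -opprD addNr.
- by rewrite add0r.
- by have [] := lattice_point_cases j.
Qed.

End LiftingFunctions.

(** * The two families and their Zariski closures *)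

Lemma poly_eq0_away0 (K : numDomainType) (q : {poly K}) :
  (forall x, x != 0 -> q.[x] = 0) -> q = 0.
Proof.
move=> q0; apply/eqP; apply: contraT => q_neq0.
(* In characteristic 0 the positive integers give more nonzero roots than the
   degree allows. *)
pose s : seq K := [seq i.+1%:R | i <- iota 0 (size q)].
suff : (size s < size q)%N by rewrite size_map size_iota ltnn.
apply: max_poly_roots => //.
  apply/allP => _ /mapP[i _ ->]; apply/eqP/q0.
  by rewrite pnatr_eq0.
rewrite map_inj_uniq ?iota_uniq // => i j /eqP.
by rewrite eqr_nat => /eqP[].
Qed.

(** Along a polynomial curve, a polynomial in several variables becomes a
    polynomial in the parameter. *)
Lemma meval_horner (A : comNzRingType) k (p : mpoly.mpoly k A)
    (h : 'I_k -> {poly A}) :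
  exists q : {poly A}, forall x, q.[x] = mpoly.meval (fun i => (h i).[x]) p.
Proof.
exists (\sum_(e <- mpoly.msupp p)
  mpoly.mcoeff e p *: \prod_i h i ^+ mpoly.fun_of_multinom e i) => x.
rewrite mpoly.mevalE horner_sum; apply: eq_bigr => e _.
rewrite hornerZ horner_prod; congr (_ * _); apply: eq_bigr => i _.
by rewrite horner_exp.
Qed.

Lemma zariski_closure_min (R : realType) l (A B : set (proj_space R l * R[i])) :
  A `<=` zariski_closure B -> zariski_closure A `<=` zariski_closure B.
Proof. by move=> AB x Ax Z Zc BZ; apply: Ax => // y /AB; apply. Qed.

Section Families.
Variables (R : realType) (n l : nat) (m : 'I_l.+1 -> 'rV[int]_n).
Implicit Types (H : 'I_l.+1 -> int) (t : 'I_n -> R[i]) (lam : R[i]).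

Lemma psi_coords_neq0 H t lam :
  (forall i, t i != 0) -> lam != 0 -> psi_coords m H t lam != 0.
Proof.
move=> t0 lam0; apply/negP => /eqP/rowP/(_ 0); rewrite !mxE => /eqP.
rewrite mulf_eq0 expfz_eq0 (negPf lam0) andbF /=.
by apply/negP/prodf_neq0 => i _; rewrite expfz_neq0.
Qed.

(** Since [(t_i lam^(-b_i))^(m_j)] has product [t^(m_j) lam^(- <b, m_j>)], moving
    in the torus trades the linear part of [H - H'] against a change of [t]. *)
Lemma psi_coords_shift H H' (b : 'rV[int]_n) (b0 : int) t lam :
  (forall j, H j = H' j + dot b (m j) + b0) -> lam != 0 ->
  psi_coords m H (fun i => t i * lam ^ (- b 0 i)) lam =
  lam ^ b0 *: psi_coords m H' t lam.
Proof.
move=> HH' lam0; apply/rowP => j; rewrite !mxE HH' !expfzDr //.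
have -> : \prod_i (t i * lam ^ (- b 0 i)) ^ m j 0 i =
    \prod_i t i ^ m j 0 i * lam ^ (- dot b (m j)).
  rewrite /dot -sumrN.
  have -> : lam ^ (\sum_(i < n) - (b 0 i * m j 0 i)) =
      \prod_i lam ^ (- (b 0 i * m j 0 i)).
    apply: (big_morph (fun z : int => lam ^ z)) => // z z'.
    by rewrite expfzDr.
  rewrite -big_split; apply: eq_bigr => i _ /=.
  by rewrite expfzMl exprz_exp mulNr.
have lamK : lam ^ dot b (m j) * lam ^ (- dot b (m j)) = 1.
  by rewrite -expfzDr // subrr.
ring: lamK.
Qed.

Lemma psi_image_shift H H' (b : 'rV[int]_n) (b0 : int)
    (x : proj_space R l * R[i]) :
  (forall j, H j = H' j + dot b (m j) + b0) -> x.2 != 0 ->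
  psi_image m H' x -> psi_image m H x.
Proof.
move=> HH' x0 [t [t0 xt]]; exists (fun i => t i * x.2 ^ (- b 0 i)).
split=> [i|]; first by rewrite mulf_neq0 // expfz_neq0.
rewrite (psi_coords_shift _ HH') // xt; apply/esym/eqP.
rewrite eqEdim -memvE memvZ ?memv_line //= !dim_vline scaler_eq0.
by rewrite expfz_eq0 (negPf x0) andbF.
Qed.

(** The exponents [H j >= 0] make the curve [lam |-> psi_coords m H t lam]
    polynomial, so its point at [lam = 0] is a limit of the others.  The test
    polynomial is evaluated along the curve [c *: psi_coords m H t lam], with [c]
    chosen to pass through a given vector of the line at [lam = 0]; thus every
    representative of the point is reached by a curve of its own. *)
Lemma zariski_closure_special H (x : proj_space R l * R[i]) :
  (forall j, 0 <= H j) -> x.2 = 0 -> psi_image m H x ->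
  zariski_closure (psi_image m H `&` [set y | y.2 != 0]) x.
Proof.
move=> H0 x0 [t [t0 xt]] _ [E [_ ->]] subZ p Ep v.
rewrite x0 in xt *; rewrite xt => /vlineP[c ->] cv0.
have c0 : c != 0 by apply: contraNneq cv0 => ->; rewrite scale0r.
pose h (k : 'I_l.+2) : {poly R[i]} := if unlift ord_max k is Some j
  then 'X^`|H j|%N * (c * \prod_i t i ^ m j 0 i)%:P else 'X.
have hE lam k : (h k).[lam] = coords (c *: psi_coords m H t lam) lam k.
  rewrite /h /coords; case: unliftP => [j _|_]; last by rewrite hornerX.
  rewrite hornerM hornerXn hornerC !mxE mulrCA; congr (_ * (_ * _)).
  by rewrite -[in RHS](gez0_abs (H0 j)).
have [q qE] := meval_horner p h.
have {}qE lam :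
    q.[lam] = mpoly.meval (coords (c *: psi_coords m H t lam) lam) p.
  by rewrite qE; apply: mpoly.meval_eq => k; exact: hE.
suff q0 : q = 0 by rewrite -qE q0 horner0.
apply: poly_eq0_away0 => lam lam0; rewrite qE.
have psi0 := psi_coords_neq0 H t0 lam0.
(* For [lam != 0] the coordinates do not all vanish and span a point of the
   projective space. *)
have dim1 : \dim <[psi_coords m H t lam]> == 1%N by rewrite dim_vline psi0.
have /subZ/(_ p Ep) : (psi_image m H `&` [set y | y.2 != 0])
    (exist (fun L : {vspace _} => \dim L == 1%N) _ dim1 : proj_space R l, lam).
  by split=> //; exists t.
apply; first by rewrite memvZ ?memv_line.
by rewrite scaler_eq0 negb_or c0.
Qed.

(** Over [lam != 0] the two images agree, and the points of the first one over
    [lam = 0] are limits of those. *)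
Lemma Xtilde_sub H H' (b : 'rV[int]_n) (b0 : int) :
  (forall j, 0 <= H' j) -> (forall j, H j = H' j + dot b (m j) + b0) ->
  Xtilde R m H' `<=` Xtilde R m H.
Proof.
move=> H'0 HH'; apply: zariski_closure_min => x xH'.
have [x0|x0] := eqVneq x.2 0.
  have xcl := zariski_closure_special H'0 x0 xH'.
  move=> Z Zc HZ; apply: xcl => // y [yH' y0].
  exact/HZ/(psi_image_shift HH').
by move=> Z _; apply; exact: psi_image_shift HH' _ _.
Qed.

End Families.

Theorem theorem3p3 (R : realType) (n l : nat) (D D1 D2 : set 'rV[R]_n)
    (m : 'I_l.+1 -> 'rV[int]_n) (a : 'rV[int]_n) (a0 : int)
    (D_polytope : lattice_polytope D)
    (D_dim : has_dim D n)
    (D_smooth : smooth_toric D)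
    (m_inj : injective m)
    (m_range : range m = [set u | D (lat R u)])
    (subdiv : lattice_subdivision D (two_pieces D1 D2))
    (D1_smooth : smooth_toric D1)
    (D2_smooth : smooth_toric D2)
    (D_semi_stable : semi_stable D (two_pieces D1 D2))
    (a_neq0 : a != 0)
    (a_cut : forall x, (D1 `&` D2) x -> dot (lat R a) x + a0%:~R = 0)
    (a_sign : forall j, D2 (lat R (m j)) -> 0 <= dot a (m j) + a0) :
  ideal_of R m (liftF D1 m a a0) = ideal_of R m (liftG D2 m a a0).
Proof.
have F0 := liftF_ge0 m_range subdiv a_sign.
have G0 := liftG_ge0 D_polytope m_range subdiv a_neq0 a_cut a_sign.
have FG := liftF_liftG m_range subdiv a_cut.
have XFG : Xtilde R m (liftF D1 m a a0) = Xtilde R m (liftG D2 m a a0).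
  apply/seteqP; split; last exact: Xtilde_sub G0 FG.
  apply: (Xtilde_sub (b := - a) (b0 := - a0) F0) => j.
  rewrite FG (_ : dot (- a) (m j) = - dot a (m j)); last first.
    by rewrite /dot -sumrN; apply: eq_bigr => i _; rewrite mxE mulNr.
  by ring.
by rewrite /ideal_of XFG.
Qed.
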